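(* Let $n>75$ be even. (1) If there exist a Steiner quadruple system $S_{2n+2}$ of order $2n+2$ and a $3$-BBD$(n)$ $B_n$, then there exists a Steiner quadruple system $S_{8n+2}$ of order $8n+2$ such that (copies of) $S_{2n+2}$ and $B_n$ are contained in $S_{8n+2}$, i.e. the block sets of $S_{2n+2}$ and of $B_n$, placed on suitable subsets of the point set of $S_{8n+2}$ of sizes $2n+2$ and $n$ respectively, are subsets of the block set of $S_{8n+2}$. (2) If there exist an $S(3,\{4,6\},2n+2)$ design $S_{2n+2}$ and a $3$-BBD$(n)$ $B_n$, then there exists an $S(3,\{4,6\},8n+2)$ design $S_{8n+2}$ containing (copies of) $S_{2n+2}$ and $B_n$ in the same sense.
   Context: A Steiner quadruple system of order $v$, $S(3,4,v)$, is a pair $(X,B)$ with $|X|=v$ and $B$ a set of $4$-element subsets of $X$ such that every $3$-subset of $X$ lies in exactly one block. An $S(3,\{4,6\},v)$ is a pair $(X,B)$ with $|X|=v$ and $B$ a set of subsets of $X$ each of size $4$ or $6$, such that every $3$-subset of $X$ lies in exactly one block. A $3$-BBD$(n)$ is a triple $(X,\{g_1,g_2\},B)$ where $|X|=n$, $\{g_1,g_2\}$ is a partition of $X$ with $|g_1|=|g_2|$, and $B$ is a set of $4$-element subsets of $X$ with $|b\cap g_1|=|b\cap g_2|=2$ for all $b\in B$, such that every $3$-subset of $X$ meeting both $g_1$ and $g_2$ lies in exactly one block. *)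

(* Defs.v *)
From mathcomp Require Import all_boot.
Set Implicit Arguments. Unset Strict Implicit. Unset Printing Implicit Defensive.

Definition S3design (K : pred nat) (T : finType) (B : {set {set T}}) : Prop :=
  (forall b, b \in B -> #|b| \in K) /\
  (forall t : {set T}, #|t| = 3 -> #|[set b in B | t \subset b]| = 1).

Definition SQS (T : finType) (B : {set {set T}}) : Prop :=
  S3design (pred1 4) B.

Definition S346 (T : finType) (B : {set {set T}}) : Prop :=
  S3design [pred k | (k == 4) || (k == 6)] B.

Definition BBD3 (T : finType) (g1 g2 : {set T}) (B : {set {set T}}) : Prop :=
  [/\ [disjoint g1 & g2], g1 :|: g2 = [set: T], #|g1| = #|g2|,
      (forall b, b \in B -> [/\ #|b| = 4, #|b :&: g1| = 2 & #|b :&: g2| = 2]) &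
      (forall t : {set T}, #|t| = 3 -> t :&: g1 != set0 -> t :&: g2 != set0 ->
         #|[set b in B | t \subset b]| = 1)].

Definition contains_copy (T T' : finType) (B : {set {set T}}) (B' : {set {set T'}})
  : Prop :=
  exists f : T -> T', injective f /\ forall b, b \in B -> f @: b \in B'.

(* Main.v *)
Require Import Defs.
From mathcomp Require Import all_boot all_algebra ring.
Set Implicit Arguments. Unset Strict Implicit. Unset Printing Implicit Defensive.

(* The points are two infinite points and four groups of size [2n], each carrying
   a copy of [S] together with the infinite points, so only the triples meeting two
   groups remain. The groups form two sides of two. Within a side, the triples are
   covered by any 3-BBD on its two groups; since [n / 2] is even, one can be chosen
   to contain [B_n]. For the other triples, split [K_{2n}] into [n] one-factors and
   [n] near-one-factors whose missing pairs partition the points. A pair [x, x'] of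
   points in the two groups of a side selects a one-factor on one group of the
   opposite side and a near-one-factor on the other; each edge is a block with
   [x, x'], and so is each missing point with one of the infinite points. Parities
   decide which group gets the near-one-factor, and which infinite point, in such a
   way that every triple with one infinite point is covered once. *)

(** * Four-element sets *)

Lemma in_set4P (T : finType) (w a b c d : T) :
  w \in [set a; b; c; d] <-> [\/ w = a, w = b, w = c | w = d].
Proof.
rewrite !inE -!orbA; split=> [/or4P[]/eqP->|[]->]; rewrite ?eqxx ?orbT //;
  [exact: Or41|exact: Or42|exact: Or43|exact: Or44].
Qed.

Lemma cards4 (T : finType) (a b c d : T) :
  uniq [:: a; b; c; d] -> #|[set a; b; c; d]| = 4.
Proof.
move=> u; have := card_uniqP u => /= <-; apply: eq_card => w.
by rewrite !inE !orbA.
Qed.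

(** * One-factorizations and idempotent Latin squares *)

Lemma eq_card_bij (T T' : finType) : #|T| = #|T'| ->
  exists (f : T -> T') (g : T' -> T), cancel f g /\ cancel g f.
Proof.
move=> e; exists (fun x => enum_val (cast_ord e (enum_rank x))).
exists (fun y => enum_val (cast_ord (esym e) (enum_rank y))).
by split=> x; rewrite enum_valK ?cast_ordK ?cast_ordKV enum_rankK.
Qed.

(* [phi c] is the involution of the 1-factor of colour [c], and [dt x y] the
   colour of the edge [xy]; the colour [o] is reserved for the loops. *)
Definition one_factorization (T : Type) (phi dt : T -> T -> T) (o : T) :=
  [/\ forall c, involutive (phi c), forall x y, phi (dt x y) x = y,
      forall c x, dt x (phi c x) = c & forall x, phi o x = x].

(* An idempotent Latin square [st], the cells of symbol [c] being the graph of
   the permutation [pi c]. *)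
Definition idempotent_square (T : Type) (pi pinv st : T -> T -> T) :=
  [/\ forall c, cancel (pi c) (pinv c), forall c, cancel (pinv c) (pi c),
      forall x y, pi (st x y) x = y, forall c x, st x (pi c x) = c &
      forall x, pi x x = x].

Section Squares.

Import GRing.Theory.
Local Open Scope ring_scope.
Variables (R : comNzRingType) (h : R).
Hypothesis hh : h + h = 1.

Let half (a : R) : h * a + h * a = a. Proof. by rewrite -mulrDl hh mul1r. Qed.

Let dbl_inj (a b : R) : a + a = b + b -> a = b.
Proof. by move=> e; rewrite -(half a) -(half b) -!mulrDr e. Qed.

(** The classical 1-factorization on [R] and a point at infinity [None]: colour [a] joins [b] to
    [a - b], and joins the fixed point [a / 2] to infinity. As a colour, [None] is that of the
    loops. *)
Definition zphi (c x : option R) : option R :=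
  match c, x with
  | None, _ => x
  | Some a, None => Some (h * a)
  | Some a, Some b => if b + b == a then None else Some (a - b)
  end.

Definition zdt (x y : option R) : option R :=
  match x, y with
  | None, None => None
  | None, Some b => Some (b + b)
  | Some a, None => Some (a + a)
  | Some a, Some b => if a == b then None else Some (a + b)
  end.

Lemma zphi_one_factorization : one_factorization zphi zdt None.
Proof.
split=> [[a|] [b|]|[a|] [b|]|[a|] [b|]|[a|]] //=.
- case: eqP => [<-|ne] /=; first by rewrite mulrDr half.
  rewrite subKr; case: eqP => // e; case: ne.
  apply/esym/eqP; rewrite -subr_eq0; apply/eqP.
  by transitivity (a - b + (a - b) - a); [ring|rewrite e subrr].
- by rewrite half eqxx.
- case: eqP => [->//|ne] /=; case: eqP => [/addrI//|_].
  by rewrite addrC addKr.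
- by rewrite eqxx.
- by rewrite mulrDr half.
- case: eqP => [<-//|ne] /=; case: eqP => [e|_]; last by congr Some; ring.
  by case: ne; rewrite {1}e subrK.
- by rewrite half.
- by rewrite eqxx.
Qed.

(* The square [2x - y] with one further row, column and symbol prolonging it
   along the transversal [y = x + 1]. *)
Definition zpi (c x : option R) : option R :=
  match c, x with
  | None, None => None
  | None, Some a => Some (a + 1)
  | Some c, None => Some (c + 2)
  | Some c, Some a => if a == c + 1 then None else Some (a + a - c)
  end.

Definition zpinv (c y : option R) : option R :=
  match c, y with
  | None, None => None
  | None, Some b => Some (b - 1)
  | Some c, None => Some (c + 1)
  | Some c, Some b => if b == c + 2 then None else Some (h * (b + c))
  end.

Definition zst (x y : option R) : option R :=
  match x, y with
  | None, None => None
  | None, Some b => Some (b - 2)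
  | Some a, None => Some (a - 1)
  | Some a, Some b => if b == a + 1 then None else Some (a + a - b)
  end.

(** Since 2 is invertible, [2x - y] is Latin. The transversal avoids the diagonal because 1 is
    nonzero, so prolongation keeps the idempotent diagonal. *)
Lemma zpi_idempotent_square : idempotent_square zpi zpinv zst.
Proof.
(* In column [c + 2] the symbol [c] sits only in row [c + 1], the transversal cell moved to the new
   row and column. *)
have E1 (a c : R) : a + a - c = c + 2 -> a = c + 1.
  by move=> e; apply: dbl_inj; rewrite -[a + a](subrK c) e; ring.
split=> [[c|] [a|]|[c|] [b|]|[a|] [b|]|[c|] [a|]|[c|]] //=.
- case: eqP => [->//|ne] /=; case: eqP => [/E1//|_].
  by rewrite subrK mulrDr half.
- by rewrite eqxx.
- by rewrite addrK.
- case: eqP => [->//|ne] /=; case: eqP => [e|_]; last by rewrite half addrK.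
  by case: ne; rewrite -[b](addrK c) -(half (b + c)) e; ring.
- by rewrite eqxx.
- by rewrite subrK.
- case: eqP => [->//|ne] /=; case: eqP => [e|_]; last by congr Some; ring.
  by case: ne; apply/eqP; rewrite -subr_eq0; apply/eqP;
    transitivity (a - (a + a - b + 1)); [ring|rewrite -e subrr].
- by rewrite subrK eqxx.
- by rewrite subrK.
- case: eqP => [->|ne] /=; first by rewrite addrK.
  case: eqP => [e|_]; last by congr Some; ring.
  by case: ne; apply/eqP; rewrite -subr_eq0; apply/eqP;
    transitivity (a + a - c - (a + 1)); [ring|rewrite e subrr].
- by rewrite addrK.
- by rewrite eqxx.
- by rewrite -{1}[c]addr0 (inj_eq (addrI _)) eq_sym oner_eq0 addrK.
Qed.

Lemma odd_Zp_half m : odd m -> (1 < m)%N -> exists h : 'Z_m, h + h = 1.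
Proof.
move=> om m1; exists (m.+1./2)%:R; rewrite -natrD addnn.
have -> : m.+1./2.*2 = m.+1 :> nat by rewrite -[RHS]odd_double_half /= om.
by rewrite -natr1 pchar_Zp // add0r.
Qed.

End Squares.

(** The bound gives [m > 1], from where on ['Z_m] really has [m] elements; [None] supplies one
    more. *)
Lemma even_card_Zp (T : finType) : ~~ odd #|T| -> 2 < #|T| ->
  exists m, [/\ odd m, 1 < m & #|T| = #|{: option 'Z_m}|].
Proof.
move=> eT T2; exists #|T|.-1; have T0 : 0 < #|T| by apply: leq_trans T2.
have m1 : 1 < #|T|.-1 by rewrite -ltnS prednK.
split=> //; first by move: eT; rewrite -{1}(prednK T0) /= negbK.
by rewrite card_option card_ord Zp_cast // prednK.
Qed.

Lemma exists_one_factorization (T : finType) : ~~ odd #|T| -> 2 < #|T| ->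
  exists phi dt (o : T), one_factorization phi dt o.
Proof.
move=> eT T2; have [m [om m1 /eq_card_bij[f [g [fK gK]]]]] := even_card_Zp eT T2.
have [h hh] := odd_Zp_half om m1; have [H1 H2 H3 H4] := zphi_one_factorization hh.
exists (fun c x => g (zphi h (f c) (f x))), (fun x y => g (zdt (f x) (f y))), (g None).
split=> [c x|x y|c x|x]; rewrite ?gK.
- by rewrite H1 fK.
- by rewrite H2 fK.
- by rewrite H3 fK.
- by rewrite H4 fK.
Qed.

Lemma exists_idempotent_square (T : finType) : ~~ odd #|T| -> 2 < #|T| ->
  exists pi pinv st : T -> T -> T, idempotent_square pi pinv st.
Proof.
move=> eT T2; have [m [om m1 /eq_card_bij[f [g [fK gK]]]]] := even_card_Zp eT T2.
have [h hh] := odd_Zp_half om m1; have [H1 H2 H3 H4 H5] := zpi_idempotent_square hh.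
exists (fun c x => g (zpi (f c) (f x))), (fun c x => g (zpinv h (f c) (f x))).
exists (fun x y => g (zst (f x) (f y))).
split=> [c x|c x|x y|c x|x]; rewrite ?gK.
- by rewrite H1 fK.
- by rewrite H2 fK.
- by rewrite H3 fK.
- by rewrite H4 fK.
- by rewrite H5 fK.
Qed.

(** * Blocks meeting both sides *)

Section Cross.

Variables (X : finType) (phi dt pi pinv st : X -> X -> X) (o : X).
Hypothesis Hphi : one_factorization phi dt o.
Hypothesis Hpi : idempotent_square pi pinv st.

Lemma dt_eq x y c : dt x y = c <-> y = phi c x.
Proof. by case: Hphi => _ H2 H3 _; split=> [<-|->]. Qed.

Lemma dtC x y : dt x y = dt y x.
Proof. by case: Hphi => H1 H2 _ _; apply/dt_eq; rewrite -{2}(H2 y x) H1. Qed.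

Lemma dt_eq_o x y : dt x y = o <-> x = y.
Proof. by case: Hphi => _ _ _ H4; rewrite dt_eq H4; split=> ->. Qed.

Lemma st_eq x y c : st x y = c <-> y = pi c x.
Proof. by case: Hpi => _ _ H2 H3 _; split=> [<-|->]. Qed.

(* Colours [(true, c)] are 1-factors of the complete graph on [bool * X];
   colour [(false, c)] misses exactly the two points [(_, c)]. *)
Definition color (z w : bool * X) : bool * X :=
  if z.1 == w.1 then (true, dt z.2 w.2)
  else if z.2 == w.2 then (true, o)
  else (false, if z.1 then st w.2 z.2 else st z.2 w.2).

Lemma colorC z w : color z w = color w z.
Proof.
rewrite /color (eq_sym w.1) (eq_sym w.2) dtC.
by case: z w => [[] a] [[] b].
Qed.

(** Inside a half, [dt] gives colour [o] to loops only, so [(true, o)] is free to match the two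
    copies of each point of [X]; the conjunct [z <> w] drops the loops. Any other [c] uses the same
    1-factor in both halves. *)
Lemma color_true c z w : (z <> w /\ color z w = (true, c)) <->
  w = if c == o then (~~ z.1, z.2) else (z.1, phi c z.2).
Proof.
rewrite /color; case: z w => [p a] [q b] /=; split.
  case=> zw; case: eqP => [pq [/dt_eq e]|pq].
    rewrite -pq e; case: eqP => // co; case: zw; rewrite pq e co.
    by case: Hphi => _ _ _ ->.
  case: eqP => // <- [<-]; rewrite eqxx; congr pair.
  by case: p q pq {zw} => -[].
case: eqP => [-> [-> ->]|co [-> ->]].
  by rewrite eqxx; case: p.
rewrite eqxx; split; last by congr pair; apply/dt_eq.
case=> e; apply: co; apply/esym; rewrite -[LHS](_ : dt a a = _); first exact/dt_eq.
exact/dt_eq_o.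
Qed.

(** Symbol [c] of the square matches the [false] half (rows) to the [true] half (columns). Its
    diagonal cell is taken out, diagonal edges having colour [(true, o)], so exactly the two copies
    of [c] stay unmatched. *)
Lemma color_false c z w : z.2 <> c -> (color z w = (false, c)) <->
  w = (~~ z.1, if z.1 then pinv c z.2 else pi c z.2).
Proof.
have [P1 P2 _ _ P5] := Hpi.
have pic a : pi c a = a -> a = c.
  by move=> /esym/st_eq <-; apply/esym/st_eq; rewrite P5.
rewrite /color; case: z w => [p a] [q b] /= ac; split.
  case: eqP => // pq; case: eqP => // ab [].
  by case: p q pq => -[] // _ /st_eq ->; rewrite ?P1.
case=> -> ->; case: p; case: eqP => // _; case: eqP => // e.
- by case: ac; apply: pic; rewrite {1}e P2.
- by congr pair; apply/st_eq; rewrite P2.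
- by case: ac; apply: pic; rewrite -e.
- by congr pair; apply/st_eq.
Qed.

Lemma color_missing c p w : color (p, c) w <> (false, c).
Proof.
have [P1 P2 _ _ P5] := Hpi.
rewrite /color; case: w => [q b] /=; case: eqP => // _; case: eqP => // cb [].
case: p => /st_eq e; apply: cb; last by rewrite e P5.
by apply: (can_inj (P1 c)); rewrite P5.
Qed.

(** The points [x], [x'] come from the two groups of a side, the edge [z w] from group [k] of the
    opposite side. The parity is true for one [k], which gets a 1-factor, and false for the other,
    which gets a near-one-factor. *)
Definition crossD (x x' : bool * X) k (z w : bool * X) :=
  (z != w) && (color z w == (k (+) x.1 (+) x'.1, dt x.2 x'.2)).

(** Here [k] is the group with the near-one-factor, [z] one of its two missing points and [h] the
    infinite point joined to it. The side bit [s] makes the rules of the two sides complementary. *)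
Definition crossI s (x x' : bool * X) k (z : bool * X) (h : bool) :=
  [&& k == x.1 (+) x'.1, z.2 == dt x.2 x'.2 & h == x.1 (+) z.1 (+) s].

Lemma crossD_irr x x' k z z' : crossD x x' k z z' -> z <> z'.
Proof. by case/andP=> /eqP. Qed.

Lemma crossD_sym x x' k z z' : crossD x x' k z z' -> crossD x x' k z' z.
Proof. by rewrite /crossD eq_sym colorC. Qed.

Lemma crossDC x x' k z z' : crossD x x' k z z' = crossD x' x k z z'.
Proof. by rewrite /crossD addbAC dtC. Qed.

(** The matching is perfect: a point unmatched inside its group is a missing point of a
    near-one-factor, and is joined to one infinite point instead. *)
Lemma crossDI_mate s x x' k z :
  (exists z', (forall w, crossD x x' k z w <-> w = z') /\
              forall h, ~ crossI s x x' k z h) \/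
  (exists h, (forall j, crossI s x x' k z j <-> j = h) /\
             forall w, ~ crossD x x' k z w).
Proof.
rewrite /crossD /crossI; case E: (k (+) x.1 (+) x'.1).
  left; exists (if dt x.2 x'.2 == o then (~~ z.1, z.2) else (z.1, phi (dt x.2 x'.2) z.2)).
  split=> [w|h].
    rewrite -color_true; split=> [/andP[/eqP ? /eqP ?]|[/eqP-> ->]] //.
    exact: eqxx.
  by case/and3P=> /eqP ek; move: E; rewrite ek; case: x.1; case: x'.1.
have ek : k == x.1 (+) x'.1 by move: E; case: k; case: x.1; case: x'.1.
have [ez|nz] := eqVneq z.2 (dt x.2 x'.2).
  right; exists (x.1 (+) z.1 (+) s); split=> [j|w]; first by rewrite ek; split=> /eqP.
  case: z ez => p a /= ->; case/andP=> _ /eqP; exact: color_missing.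
left.
exists (~~ z.1, if z.1 then pinv (dt x.2 x'.2) z.2 else pi (dt x.2 x'.2) z.2).
split=> [w|h]; last by rewrite andbF.
rewrite -color_false; last exact/eqP.
split=> [/andP[_ /eqP]//|e]; rewrite e eqxx andbT; apply: contra_eqN e => /eqP <-.
by rewrite /color eqxx.
Qed.

(** The two missing points differ in their first bit, so each infinite point receives one of
    them. *)
Lemma crossI_mate s x x' h :
  exists k z, forall j w, crossI s x x' j w h <-> j = k /\ w = z.
Proof.
exists (x.1 (+) x'.1), (h (+) x.1 (+) s, dt x.2 x'.2) => j w; rewrite /crossI.
split=> [/and3P[/eqP-> /eqP <- /eqP->]|[-> ->]] /=; last first.
  by rewrite !eqxx; case: h; case: x.1; case: s.
by split=> //; case: w => p a /=; congr pair; case: p; case: x.1; case: s.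
Qed.

(** The colour of the edge determines [x']: its bit fixes [x'.1], and its second component fixes
    [x'.2], since every point of [X] meets each colour of [dt] once, [o] included (at the loop). *)
Lemma crossD_matel x k z z' : z <> z' ->
  exists x', forall w, crossD x w k z z' <-> w = x'.
Proof.
move=> /eqP zz'; rewrite /crossD zz' /=; case: (color z z') => p c.
exists (p (+) k (+) x.1, phi c x.2) => -[q b]; rewrite xpair_eqE /=.
split=> [/andP[/eqP-> /eqP/esym/dt_eq->]|[-> ->]].
  by congr pair; case: k; case: q; case: x.1.
apply/andP; split; first by case: k; case: p; case: x.1.
by apply/eqP/esym/dt_eq.
Qed.

Lemma crossD_mater x k z z' : z <> z' ->
  exists x', forall w, crossD w x k z z' <-> w = x'.
Proof.
by move=> /(crossD_matel x k)[x' H]; exists x' => w; rewrite crossDC.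
Qed.

(** Here [x] lies in group [i] of a side, [y] in group [j] of the opposite one, and [x'] is the
    partner of [x]. For [i] true the bit entering [h] is that of the partner, [j (+) x.1]; hence the
    term [i && j]. *)
Lemma crossI_eq s (i : bool) x x' j y h :
  (if i then crossI s x' x else crossI s x x') j y h <->
  x' = (j (+) x.1, phi y.2 x.2) /\ h = x.1 (+) (i && j) (+) y.1 (+) s.
Proof.
case: x x' y => [e c] [q b] [f d]; rewrite /crossI /=; split.
  case: i => /and3P[/eqP-> /eqP ed /eqP->]; move/esym: ed.
    by rewrite dtC => /dt_eq->; split; [congr pair|]; case: e; case: q; case: f.
  by move/dt_eq=> ->; split; [congr pair|]; case: e; case: q; case: f.
case=> -[-> ->] ->.
have E : dt c (phi d c) = d by apply/dt_eq.
by case: i; rewrite ?(dtC (phi d c)) E eqxx /=; case: j; case: e; case: f; case: s.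
Qed.

(** Either side prescribes [h] by the formula of [crossI_eq]. It is symmetric under exchanging
    [(i, x)] and [(j, y)] apart from the bit [s], so the two sides prescribe opposite values and
    exactly one of them supplies a block. *)
Lemma crossI_cross h (i j : bool) x y :
  (exists x', (forall w, (if i then crossI false w x else crossI false x w) j y h
                         <-> w = x') /\
     forall w, ~ (if j then crossI true w y else crossI true y w) i x h) \/
  (exists y', (forall w, (if j then crossI true w y else crossI true y w) i x h
                         <-> w = y') /\
     forall w, ~ (if i then crossI false w x else crossI false x w) j y h).
Proof.
have [eh|nh] := eqVneq h (x.1 (+) (i && j) (+) y.1); [left|right].
  exists (j (+) x.1, phi y.2 x.2); split=> w; rewrite crossI_eq.
    by rewrite addbF; split=> [[]|].
  by case=> _; rewrite eh; case: i {eh}; case: j; case: x.1; case: y.1.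
exists (i (+) y.1, phi x.2 y.2); split=> w; rewrite crossI_eq.
  split=> [[]//|->]; split=> //.
  by move: nh; case: h; case: i; case: j; case: x.1; case: y.1.
by rewrite addbF => -[_ /eqP]; apply/negP.
Qed.

End Cross.

(** * 3-BBDs with a prescribed subsystem *)

Lemma fpf_involution_even (T : finType) (f : T -> T) :
  involutive f -> (forall x, f x != x) -> ~~ odd #|T|.
Proof.
(* [A] takes the lower-ranked element of each orbit; [f] carries it onto its complement. *)
move=> fK fx; pose A := [set x | enum_rank x < enum_rank (f x)].
have -> : #|T| = #|A| + #|A|; last by rewrite addnn odd_double.
rewrite -cardsT -(cardsID A setT) setTI setTD; congr addn.
rewrite -(card_imset _ (inv_inj fK)); apply: eq_card => x.
rewrite -{1}(fK x) mem_imset ?inE; last exact: inv_inj.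
rewrite fK -leqNgt leq_eqVlt; case: eqP => // /val_inj/enum_rank_inj e.
by have := fx x; rewrite -e eqxx.
Qed.

(* [t a a' c c'] encodes the block [{a, a', c, c'}] of a 3-BBD on two disjoint
   copies of [V], with [a, a'] in the first and [c, c'] in the second. *)
Definition bbd_relation (V : Type) (t : V -> V -> V -> V -> bool) :=
  [/\ forall a a' c c', t a a' c c' -> a <> a' /\ c <> c',
      forall a a' c c', t a a' c c' -> t a' a c c',
      forall a a' c c', t a a' c c' -> t a a' c' c,
      forall a a' c, a <> a' -> exists c', forall w, t a a' c w <-> w = c' &
      forall c c' a, c <> c' -> exists a', forall w, t a w c c' <-> w = a'].

Lemma bbd_relation_swap V (t : V -> V -> V -> V -> bool) :
  bbd_relation t -> bbd_relation (fun a a' c c' => t c c' a a').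
Proof.
case=> H1 H2 H3 H4 H5; split=> //; first by move=> a a' c c' /H1[].
- by move=> a a' c c'; apply: H3.
- by move=> a a' c c'; apply: H2.
Qed.

Lemma BBD3_swap (T : finType) (g1 g2 : {set T}) B : BBD3 g1 g2 B -> BBD3 g2 g1 B.
Proof.
case=> H1 H2 H3 H4 H5; split=> //; first by rewrite disjoint_sym.
- by rewrite setUC.
- by move=> b /H4[].
- by move=> t t3 tg2 tg1; apply: H5.
Qed.

Section BBDRelation.

Variables (T J : finType) (g1 g2 : {set T}) (B : {set {set T}}) (f1 f2 : J -> T).
Hypothesis f1_inj : injective f1.
Hypothesis f2_inj : injective f2.
Hypothesis f1_im : forall x, x \in g1 <-> exists j, x = f1 j.
Hypothesis f2_im : forall x, x \in g2 <-> exists j, x = f2 j.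

Definition bbd_rel j j' l l' :=
  [&& j != j', l != l' & [set f1 j; f1 j'; f2 l; f2 l'] \in B].

(** The triple lies in a unique block, which meets [g2] in one more point besides [f2 l]; that point
    gives [l']. *)
Lemma bbd_rel_mater : BBD3 g1 g2 B -> forall j j' l, j <> j' ->
  exists l', forall w, bbd_rel j j' l w <-> w = l'.
Proof.
case=> dis _ _ Bsz Bcov j j' l jj'.
have f1g j0 : f1 j0 \in g1 by apply/f1_im; exists j0.
have f2g j0 : f2 j0 \in g2 by apply/f2_im; exists j0.
have f12 j0 l0 : f1 j0 <> f2 l0.
  by move=> e; have := disjointFr dis (f1g j0); rewrite e f2g.
have njj : f1 j != f1 j' by apply/eqP=> /f1_inj.
have c3 : #|[set f1 j; f1 j'; f2 l]| = 3.
  by rewrite -setUA cardsU1 cards2 !inE (negPf njj) /=; do 2!case: eqP => [/f12//|_].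
have /cards1P[b Eb] : #|[set b in B | [set f1 j; f1 j'; f2 l] \subset b]| == 1.
  apply/eqP/Bcov => //; apply/set0Pn; [exists (f1 j)|exists (f2 l)];
  by rewrite !inE eqxx ?orbT ?f1g ?f2g.
have : b \in [set b in B | [set f1 j; f1 j'; f2 l] \subset b] by rewrite Eb set11.
rewrite inE -setUA !subUset !sub1set => /and4P[bB bj bj' bl].
have [b4 _ b2] := Bsz _ bB.
have : 0 < #|(b :&: g2) :\ f2 l|.
  by move: b2; rewrite (cardsD1 (f2 l)) !inE bl f2g /= add1n => -[->].
case/card_gt0P=> y; rewrite !inE => /and3P[yl yb /f2_im[l' El']]; subst y.
have ll' : l != l' by apply: contraNneq yl => ->.
have card4 w : l != w -> #|[set f1 j; f1 j'; f2 l; f2 w]| = 4.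
  move=> lw; rewrite cards4 //= !inE !negb_or njj (inj_eq f2_inj) lw /= andbT.
  by do 4!case: eqP => [/f12//|_].
have Eb' : [set f1 j; f1 j'; f2 l; f2 l'] = b.
  apply/eqP; rewrite eqEcard b4 card4 // leqnn andbT.
  by rewrite !subUset !sub1set bj bj' bl yb.
exists l' => w; rewrite /bbd_rel; split=> [/and3P[_ lw]|->]; last first.
  by rewrite Eb' bB ll' !andbT; apply/eqP.
move=> wB; have : [set f1 j; f1 j'; f2 l; f2 w] \in [set b].
  rewrite -Eb inE wB; apply/subsetP=> x; rewrite !inE.
  by case/orP=> [/orP[]|]->; rewrite ?orbT.
move/set1P=> Ew.
have : f2 w \in b by rewrite -Ew !inE eqxx orbT.
rewrite -Eb' => /in_set4P[/esym/f12|/esym/f12|/f2_inj e|/f2_inj] //.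
by rewrite e eqxx in lw.
Qed.

Lemma bbd_rel_syml j j' l l' : bbd_rel j j' l l' -> bbd_rel j' j l l'.
Proof. by rewrite /bbd_rel eq_sym (setUC [set f1 j]). Qed.

Lemma bbd_rel_symr j j' l l' : bbd_rel j j' l l' -> bbd_rel j j' l' l.
Proof. by rewrite /bbd_rel (eq_sym l) (setUAC _ [set f2 l]). Qed.

End BBDRelation.

Lemma bbd_rel_swap (T J : finType) (B : {set {set T}}) (f1 f2 : J -> T) j j' l l' :
  bbd_rel B f1 f2 j j' l l' = bbd_rel B f2 f1 l l' j j'.
Proof.
rewrite /bbd_rel andbCA; congr [&& _, _ & _ \in B].
by rewrite -setUA setUC !setUA.
Qed.

Lemma bbd_rel_relation (T J : finType) (g1 g2 : {set T}) B (f1 f2 : J -> T) :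
  injective f1 -> injective f2 ->
  (forall x, x \in g1 <-> exists j, x = f1 j) ->
  (forall x, x \in g2 <-> exists j, x = f2 j) ->
  BBD3 g1 g2 B -> bbd_relation (bbd_rel B f1 f2).
Proof.
move=> f1I f2I f1g f2g BB; split.
- by move=> j j' l l' /and3P[/eqP ? /eqP ?].
- exact: bbd_rel_syml.
- exact: bbd_rel_symr.
- exact: (bbd_rel_mater f1I f2I f1g f2g BB).
move=> l l' j /(bbd_rel_mater f2I f1I f2g f1g (BBD3_swap BB) j)[j' H].
by exists j' => w; rewrite bbd_rel_swap.
Qed.

(** For fixed distinct [j] and [j'], sending [l] to the [l'] with [r j j' l l'] is a
    fixed-point-free involution of [J]. *)
Lemma bbd_relation_even (J : finType) (r : J -> J -> J -> J -> bool) :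
  bbd_relation r -> 1 < #|J| -> ~~ odd #|J|.
Proof.
case=> irr _ symr mater _ /card_gt1P[j [j' [_ _ /eqP jj']]].
(* The default is never taken, since the partner of [l] exists. *)
pose f l := odflt l [pick w | r j j' l w].
have fP l w : r j j' l w <-> w = f l.
  have [l' H] := mater j j' l jj'; rewrite /f; case: pickP => [u /H ->|/(_ l')] //=.
  by rewrite (iffRL (H l') erefl).
apply: (@fpf_involution_even _ f) => l.
  by apply/esym/fP/symr/fP.
by apply/eqP => e; case: (irr j j' l l) => //; apply/fP; rewrite e.
Qed.

(** * Quadrupling a 3-BBD *)

Section Quadruple.

Variables (J : finType) (r : J -> J -> J -> J -> bool) (phi dt : J -> J -> J) (o : J).
Hypothesis Hphi : one_factorization phi dt o.

Local Notation W := ((bool * bool) * J)%type.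

Definition addb2 (u v : bool * bool) := (u.1 (+) v.1, u.2 (+) v.2).

(* The product colouring of [Z_2^2 * J] gives a 3-BBD on two copies of it;
   on the subsystem [0 * J] its blocks are traded for those of [r]. *)
Definition quad_rel (a a' c c' : W) :=
  [&& a != a', c != c', addb2 a.1 a'.1 == addb2 c.1 c'.1 &
    if [&& a.1 == (false, false), a'.1 == (false, false),
           c.1 == (false, false) & c'.1 == (false, false)]
    then r a.2 a'.2 c.2 c'.2 else dt a.2 a'.2 == dt c.2 c'.2].

Lemma quad_rel_mater : bbd_relation r -> forall a a' c, a <> a' ->
  exists c', forall w, quad_rel a a' c w <-> w = c'.
Proof.
case=> irr _ _ mater _ [u j] [u' j'] [v l] /eqP aa'.
rewrite /quad_rel aa' /=; move/eqP: aa' => aa'.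
(* The sum condition forces the fourth point into [0 * J] once the other three are there, so the
   trade stays inside the subsystem. *)
case: (boolP [&& u == (false, false), u' == (false, false) & v == (false, false)]).
  case/and3P=> /eqP Eu /eqP Eu' /eqP Ev; subst u u' v.
  have jj' : j <> j' by move=> e; apply: aa'; rewrite e.
  have [l' H] := mater j j' l jj'.
  exists (false, false, l') => -[[p q] w] /=; split=> [/and3P[_ /eqP[<- <-] /=]|].
    by move/H->.
  case=> -> -> ->; rewrite /=; have R := iffRL (H l') erefl.
  by rewrite R andbT; apply/eqP=> -[e]; case: (irr _ _ _ _ R).
move=> n0; exists (addb2 (addb2 u u') v, phi (dt j j') l) => -[p w] /=.
have -> : [&& u == (false, false), u' == (false, false), v == (false, false)
  & p == (false, false)] = false by apply/negbTE; apply: contra n0 => /and4P[-> ->].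
split=> [/and3P[_ /eqP e /eqP/esym/(dt_eq Hphi) ->]|[-> ->]].
  congr pair; move: e; case: u u' v p {n0 aa'} => [[] []] [[] []] [[] []] [[] []] //.
rewrite (iffRL (dt_eq Hphi l _ _) erefl) eqxx andbT; apply/andP; split.
  (* If the fourth point equalled the third, the sums would give [u = u'] and the common colour
     would be [o], whence [j = j']. *)
  apply: contra_notN aa' => /eqP[ev el]; congr pair.
    by move: ev; case: u u' v {n0} => [[] []] [[] []] [[] []].
  have /(dt_eq Hphi) e := el; apply/(dt_eq_o Hphi); rewrite -e; exact/(dt_eq_o Hphi).
by case: u u' v {n0 aa'} => [[] []] [[] []] [[] []].
Qed.

End Quadruple.

Lemma quad_rel_swap (J : finType) r (dt : J -> J -> J) a a' c c' :
  quad_rel r dt a a' c c' = quad_rel (fun j j' l l' => r l l' j j') dt c c' a a'.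
Proof.
rewrite /quad_rel andbCA (eq_sym (addb2 a.1 _)) (eq_sym (dt a.2 _)).
congr [&& _, _, _ & if _ then _ else _].
by do 4!case: (_ == (false, false)).
Qed.

Lemma quad_rel_relation (J : finType) r (phi dt : J -> J -> J) o :
  one_factorization phi dt o -> bbd_relation r -> bbd_relation (quad_rel r dt).
Proof.
move=> Hphi Hr; have [irr syml symr _ _] := Hr; split.
- by move=> a a' c c' /and4P[/eqP ? /eqP].
- move=> a a' c c'; rewrite /quad_rel (eq_sym a) (dtC Hphi a.2) andbCA.
  case/and4P=> -> -> /eqP<-; rewrite /addb2 !(addbC a.1.1) !(addbC a.1.2) eqxx /=.
  by rewrite andbCA; case: ifP => // _ /syml.
- move=> a a' c c'; rewrite /quad_rel (eq_sym c) (dtC Hphi c.2).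
  case/and4P=> -> -> /eqP->; rewrite /addb2 !(addbC c.1.1) !(addbC c.1.2) eqxx /=.
  by rewrite (andbC (c.1 == _)); case: ifP => // _ /symr.
- exact: (quad_rel_mater Hphi Hr).
move=> c c' a /(quad_rel_mater Hphi (bbd_relation_swap Hr) a)[a' H]; exists a' => w.
by rewrite quad_rel_swap.
Qed.

Lemma bbd_relation_transport (V W : Type) (f : V -> W) (g : W -> V) t :
  cancel f g -> cancel g f -> bbd_relation t ->
  bbd_relation (fun a a' c c' => t (f a) (f a') (f c) (f c')).
Proof.
move=> fK gK [H1 H2 H3 H4 H5]; split.
- by move=> a a' c c' /H1[n1 n2]; split=> e; [apply: n1|apply: n2]; rewrite e.
- by move=> a a' c c' /H2.
- by move=> a a' c c' /H3.
- move=> a a' c aa'; have /(H4 _ _ (f c))[c' H] : f a <> f a' by move/(can_inj fK).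
  by exists (g c') => w; rewrite H; split=> [<-|->].
- move=> c c' a cc'; have /(H5 _ _ (f a))[a' H] : f c <> f c' by move/(can_inj fK).
  by exists (g a') => w; rewrite H; split=> [<-|->].
Qed.

(** The groups have even size by [bbd_relation_even], so their index set [J] has the
    one-factorization that quadrupling needs; [B] lands on the copy [0 * J]. Both groups are sent
    into the same [V], so injectivity of [e] is claimed on each separately. *)
Lemma exists_bbd_relation (T V : finType) (g1 g2 : {set T}) B :
  BBD3 g1 g2 B -> 2 < #|g1| -> #|V| = 4 * #|g1| ->
  exists (t : V -> V -> V -> V -> bool) (e : T -> V),
  [/\ bbd_relation t, {in g1 &, injective e}, {in g2 &, injective e} &
      forall b, b \in B -> exists a a' c c',
      [/\ a \in g1, a' \in g1, c \in g2 & c' \in g2] /\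
      b = [set a; a'; c; c'] /\ t (e a) (e a') (e c) (e c')].
Proof.
move=> BB g12 cV; have [dis cov eg Bsz _] := BB.
pose J : finType := 'I_#|g1|.
have [x1 x1g] : exists x, x \in g1 by apply/card_gt0P; apply: leq_trans g12.
have [x2 x2g] : exists x, x \in g2 by apply/card_gt0P; rewrite -eg; apply: leq_trans g12.
pose f1 (j : J) : T := enum_val j; pose f2 (j : J) : T := enum_val (cast_ord eg j).
pose k x : J := if x \in g1 then enum_rank_in x1g x
  else cast_ord (esym eg) (enum_rank_in x2g x).
have f1k x : x \in g1 -> f1 (k x) = x by move=> xg; rewrite /k xg /f1 enum_rankK_in.
have f2k x : x \in g2 -> f2 (k x) = x.
  by move=> xg; rewrite /k (disjointFl dis xg) /f2 cast_ordKV enum_rankK_in.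
have f1g j : f1 j \in g1 by apply: enum_valP.
have f2g j : f2 j \in g2 by apply: enum_valP.
have f1I : injective f1 by apply: enum_val_inj.
have f2I : injective f2 by move=> i j /enum_val_inj/cast_ord_inj.
have f1im x : x \in g1 <-> exists j, x = f1 j.
  by split=> [xg|[j ->]//]; exists (k x); rewrite f1k.
have f2im x : x \in g2 <-> exists j, x = f2 j.
  by split=> [xg|[j ->]//]; exists (k x); rewrite f2k.
have Hr := bbd_rel_relation f1I f2I f1im f2im BB.
have cJ : #|J| = #|g1| by rewrite card_ord.
have oJ : ~~ odd #|J| by apply: (bbd_relation_even Hr); rewrite cJ ltnW.
have [phi [dt [o Hphi]]] : exists phi dt (o : J), one_factorization phi dt o.
  by apply: exists_one_factorization; rewrite ?cJ // -cJ.
have /eq_card_bij[f [g [fK gK]]] : #|V| = #|{: (bool * bool) * J}|.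
  by rewrite cV !card_prod card_bool card_ord.
have Ht := bbd_relation_transport fK gK (quad_rel_relation Hphi Hr).
exists (fun a a' c c' => quad_rel (bbd_rel B f1 f2) dt (f a) (f a') (f c) (f c')).
exists (fun x => g ((false, false), k x)); split=> //.
- by move=> x y xg yg /(can_inj gK)[e]; rewrite -(f1k x) // e f1k.
- by move=> x y xg yg /(can_inj gK)[e]; rewrite -(f2k x) // e f2k.
move=> b bB; have [b4 /eqP/cards2P[a [a' [aa' Ea]]] /eqP/cards2P[c [c' [cc' Ec]]]] := Bsz b bB.
have /setIP[_ ag] : a \in b :&: g1 by rewrite Ea !inE eqxx.
have /setIP[_ a'g] : a' \in b :&: g1 by rewrite Ea !inE eqxx orbT.
have /setIP[_ cg] : c \in b :&: g2 by rewrite Ec !inE eqxx.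
have /setIP[_ c'g] : c' \in b :&: g2 by rewrite Ec !inE eqxx orbT.
have Eb : b = [set a; a'; c; c'].
  by rewrite -[b]setIT -cov setIUr Ea Ec setUA.
exists a, a', c, c'; split; [by []|split=> //].
rewrite !gK /quad_rel /= /bbd_rel f1k // f1k // f2k // f2k // -Eb bB !andbT.
rewrite !xpair_eqE !eqxx /=.
have -> : k a != k a' by apply: contraNneq aa' => e; rewrite -(f1k a) // e f1k.
by have -> : k c != k c' by apply: contraNneq cc' => e; rewrite -(f2k c) // e f2k.
Qed.

(** * Assembling the design *)

Section Points.

Variable V : finType.

(** In [(s, i, x)] the bit [s] is the side and [i] the group within it; the left summand holds the
    infinite points. *)
Definition points : finType := (bool + (bool * bool) * V)%type.

Definition inf (h : bool) : points := inl h.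

Definition pt (s i : bool) (x : V) : points := inr (s, i, x).

Definition emb (g : bool * bool) (z : bool + V) : points :=
  match z with inl h => inl h | inr v => inr (g, v) end.

Lemma emb_inj g : injective (emb g).
Proof. by move=> [h|v] [h'|v'] // []->. Qed.

Lemma emb_pt g (c : {set bool + V}) s i x : pt s i x \in emb g @: c -> g = (s, i).
Proof. by case/imsetP=> -[h|v] _ // [->]. Qed.

End Points.

Arguments inf {V} h.

Section Assembly.

Variable V : finType.
Local Notation P := (points V).
Variable D : V -> V -> bool -> V -> V -> bool.
Variable I : bool -> V -> V -> bool -> V -> bool -> bool.
Variable t : V -> V -> V -> V -> bool.
Variable K : pred nat.
Variable S : {set {set (bool + V)}}.

Hypothesis K4 : 4 \in K.
Hypothesis SP : S3design K S.
Hypothesis D_irr : forall x x' k z z', D x x' k z z' -> z <> z'.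
Hypothesis D_sym : forall x x' k z z', D x x' k z z' -> D x x' k z' z.
Hypothesis DI_mate : forall s x x' k z,
  (exists z', (forall w, D x x' k z w <-> w = z') /\ forall h, ~ I s x x' k z h) \/
  (exists h, (forall j, I s x x' k z j <-> j = h) /\ forall w, ~ D x x' k z w).
Hypothesis I_mate : forall s x x' h,
  exists k z, forall j w, I s x x' j w h <-> j = k /\ w = z.
Hypothesis D_matel : forall x k z z', z <> z' ->
  exists x', forall w, D x w k z z' <-> w = x'.
Hypothesis D_mater : forall x k z z', z <> z' ->
  exists x', forall w, D w x k z z' <-> w = x'.
Let I' s i x x' := if i then I s x' x else I s x x'.
Hypothesis I_cross : forall h i j x y,
  (exists x', (forall w, I' false i x w j y h <-> w = x') /\
              forall w, ~ I' true j y w i x h) \/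
  (exists y', (forall w, I' true j y w i x h <-> w = y') /\
              forall w, ~ I' false i x w j y h).
Hypothesis t_irr : forall a a' c c', t a a' c c' -> a <> a' /\ c <> c'.
Hypothesis t_syml : forall a a' c c', t a a' c c' -> t a' a c c'.
Hypothesis t_symr : forall a a' c c', t a a' c c' -> t a a' c' c.
Hypothesis t_mater : forall a a' c, a <> a' ->
  exists c', forall w, t a a' c w <-> w = c'.
Hypothesis t_matel : forall c c' a, c <> c' ->
  exists a', forall w, t a w c c' <-> w = a'.

(* The two sides [s] consist of the two groups [(s, false)] and [(s, true)].
   Each pair of points from different groups of a side gets a perfect matching
   of the opposite side plus the two infinite points; its edges within a group
   give the blocks [D], those through an infinite point the blocks [I]. *)
Variant assembly_block : {set P} -> Prop :=
| BlockS g c : c \in S -> assembly_block (emb g @: c)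
| BlockD s x x' k z z' : D x x' k z z' ->
    assembly_block [set pt s false x; pt s true x'; pt (~~ s) k z; pt (~~ s) k z']
| BlockI s x x' k z h : I s x x' k z h ->
    assembly_block [set pt s false x; pt s true x'; pt (~~ s) k z; inf h]
| BlockT s a a' c c' : t a a' c c' ->
    assembly_block [set pt s false a; pt s false a'; pt s true c; pt s true c'].

(** Phrased with points instead of 3-subsets, so that the cases can be permuted by [coveredC] and
    [coveredAC]. *)
Definition covered a b c := exists2 B0, assembly_block B0 &
  [/\ a \in B0, b \in B0, c \in B0 & forall B, assembly_block B ->
   a \in B -> b \in B -> c \in B -> B = B0].

Lemma coveredC a b c : covered a b c -> covered b a c.
Proof. by case=> B BB [? ? ? h]; exists B => //; split=> // B' ? ? ? ?; apply: h. Qed.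

Lemma coveredAC a b c : covered a b c -> covered a c b.
Proof. by case=> B BB [? ? ? h]; exists B => //; split=> // B' ? ? ? ?; apply: h. Qed.

(** The design [S] gives existence, and uniqueness among the blocks of the same copy. Blocks of the
    three other kinds meet a group plus the infinite points in at most two points. *)
Lemma covered_group g a b c : a <> b -> a <> c -> b <> c ->
  covered (emb g a) (emb g b) (emb g c).
Proof.
move=> ab ac bc.
have c3 : #|[set a; b; c]| = 3.
  by rewrite -setUA cardsU1 cards2 !inE; do ![case: eqP => //].
have [SK SU] := SP.
have /eqP/cards1P[B0 EB] := SU _ c3.
have : B0 \in [set b0 in S | [set a; b; c] \subset b0] by rewrite EB set11.
rewrite inE => /andP[SB0 /subsetP sB0].
exists (emb g @: B0); first exact: BlockS.
split; try by apply/imset_f/sB0; rewrite !inE eqxx ?orbT.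
move=> B [{B} g' c' Sc|{B} s x x' k z z' d|{B} s x x' k z h d|{B} s x x' z z' d] Ha Hb Hc.
- have [E|NE] := eqVneq g g'; last first.
    have isinf w : emb g w \in emb g' @: c' -> exists h, w = inl h.
      case: w => [h|v]; first by exists h.
      by case/imsetP=> -[|v'] // _ [E]; rewrite E eqxx in NE.
    (* Two different copies share only the two infinite points, too few for three distinct
       points. *)
    case: (isinf _ Ha) (isinf _ Hb) (isinf _ Hc) => ha ea [hb eb] [hc ec].
    by exfalso; move: ab ac bc; rewrite ea eb ec; case: ha {ea}; case: hb {eb}; case: hc {ec}; congruence.
  subst g'; suff -> : c' = B0 by [].
  suff : c' \in [set b0 in S | [set a; b; c] \subset b0] by rewrite EB => /set1P.
  rewrite inE Sc; apply/subsetP => w; rewrite !inE => /orP[/orP[]|]/eqP->.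
  + by move: Ha; rewrite mem_imset //; apply: emb_inj.
  + by move: Hb; rewrite mem_imset //; apply: emb_inj.
  + by move: Hc; rewrite mem_imset //; apply: emb_inj.
all: exfalso; case: s d Ha Hb Hc => d /in_set4P Ha /in_set4P Hb /in_set4P Hc;
  move: ab ac bc; case: a Ha {c3 EB sB0} => a Ha; case: b Hb => b Hb; case: c Hc => c Hc;
  rewrite /pt /inf /= in Ha Hb Hc; case: Ha => Ha; try discriminate Ha;
  case: Hb => Hb; try discriminate Hb; case: Hc => Hc; try discriminate Hc; congruence.
Qed.

Ltac mem4 H := case: (iffLR (in_set4P _ _ _ _ _) H) => {}H; try discriminate H.
Ltac set4 := by apply/setP=> ?; rewrite !inE; do ![case: (_ == _)].
Ltac inj := repeat match goal with
  | H : pt _ _ _ = pt _ _ _ |- _ => case: H; intros; subst; try discriminate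
  | H : inf _ = inf _ |- _ => case: H; intros; subst; try discriminate
  end.
Ltac start := split; [by rewrite !inE eqxx ?orbT ..|].
Ltac splitmem Ha Hb Hc := mem4 Ha; mem4 Hb; mem4 Hc; inj.

(** Only [BlockD] and [BlockI] based on side [s] meet both its groups and the opposite side;
    [DI_mate] leaves exactly one of them. *)
Lemma covered_side_cross s x x' k z :
  covered (pt s false x) (pt s true x') (pt (~~ s) k z).
Proof.
case: (DI_mate s x x' k z) => [[z' [H1 H2]]|[h [H1 H2]]].
  exists [set pt s false x; pt s true x'; pt (~~ s) k z; pt (~~ s) k z'].
    by apply: BlockD; apply/H1.
  start.
  move=> B [{B} g0 c0 _|{B} s0 x0 x0' k0 z0 z0' d|{B} s0 x0 x0' k0 z0 h0 d
           |{B} s0 x0 x0' z0 z0' d] Ha Hb Hc.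
  - by move: (emb_pt Ha) (emb_pt Hb); congruence.
  - case: s s0 Ha Hb Hc {H2} => -[] Ha Hb Hc; splitmem Ha Hb Hc;
      by [move/H1: d => -> | move/D_sym/H1: d => ->; set4].
  - case: s s0 Ha Hb Hc H2 d => -[] Ha Hb Hc H2 d; splitmem Ha Hb Hc;
     by case: (H2 h0).
  - by case: s s0 Ha Hb Hc {H2} => -[] Ha Hb Hc; splitmem Ha Hb Hc.
exists [set pt s false x; pt s true x'; pt (~~ s) k z; inf h].
  by apply: BlockI; apply/H1.
start.
move=> B [{B} g0 c0 _|{B} s0 x0 x0' k0 z0 z0' d|{B} s0 x0 x0' k0 z0 h0 d
         |{B} s0 x0 x0' z0 z0' d] Ha Hb Hc.
- by move: (emb_pt Ha) (emb_pt Hb); congruence.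
- case: s s0 Ha Hb Hc {H1} => -[] Ha Hb Hc; splitmem Ha Hb Hc;
    by [case: (H2 _ d) | move/D_sym/H2: d].
- case: s s0 Ha Hb Hc H1 d => -[] Ha Hb Hc H1 d; splitmem Ha Hb Hc;
   by move/H1: d => ->.
- by case: s s0 Ha Hb Hc {H1} => -[] Ha Hb Hc; splitmem Ha Hb Hc.
Qed.

Lemma covered_inf_side s x x' h :
  covered (pt s false x) (pt s true x') (inf h).
Proof.
have [k [z H1]] := I_mate s x x' h.
exists [set pt s false x; pt s true x'; pt (~~ s) k z; inf h].
  by apply: BlockI; apply/H1.
start.
move=> B [{B} g0 c0 _|{B} s0 x0 x0' k0 z0 z0' d|{B} s0 x0 x0' k0 z0 h0 d
         |{B} s0 x0 x0' z0 z0' d] Ha Hb Hc.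
- by move: (emb_pt Ha) (emb_pt Hb); congruence.
- by case: s s0 Ha Hb Hc {H1} => -[] Ha Hb Hc; splitmem Ha Hb Hc.
- case: s s0 Ha Hb Hc H1 d => -[] Ha Hb Hc H1 d; splitmem Ha Hb Hc;
   by case/H1: d => -> ->.
- by case: s s0 Ha Hb Hc {H1} => -[] Ha Hb Hc; splitmem Ha Hb Hc.
Qed.

(** Only [BlockD] based on side [s] can occur, and the edge [z z'] determines the partner of [x] in
    the other group of that side. *)
Lemma covered_pair_cross s k z z' i x : z <> z' ->
  covered (pt (~~ s) k z) (pt (~~ s) k z') (pt s i x).
Proof.
move=> zz'; case: i.
  have [x' H1] := D_mater x k zz'.
  exists [set pt s false x'; pt s true x; pt (~~ s) k z; pt (~~ s) k z'].
    by apply: BlockD; apply/H1.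
  start.
  move=> B [{B} g0 c0 _|{B} s0 x0 x0' k0 z0 z0' d|{B} s0 x0 x0' k0 z0 h0 d
         |{B} s0 x0 x0' u0 u0' d] Ha Hb Hc.
  - by case: s Ha Hb Hc => Ha Hb Hc; move: (emb_pt Ha) (emb_pt Hc) => /=; congruence.
  - case: s s0 Ha Hb Hc => -[] Ha Hb Hc; splitmem Ha Hb Hc => //;
     by [move/H1: d => -> | move/D_sym/H1: d => ->; set4].
  - by case: s s0 Ha Hb Hc d => -[] Ha Hb Hc d; splitmem Ha Hb Hc.
  - by case: s s0 Ha Hb Hc => -[] Ha Hb Hc; splitmem Ha Hb Hc.
have [x' H1] := D_matel x k zz'.
exists [set pt s false x; pt s true x'; pt (~~ s) k z; pt (~~ s) k z'].
  by apply: BlockD; apply/H1.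
start.
move=> B [{B} g0 c0 _|{B} s0 x0 x0' k0 z0 z0' d|{B} s0 x0 x0' k0 z0 h0 d
       |{B} s0 x0 x0' u0 u0' d] Ha Hb Hc.
- by case: s Ha Hb Hc => Ha Hb Hc; move: (emb_pt Ha) (emb_pt Hc) => /=; congruence.
- case: s s0 Ha Hb Hc => -[] Ha Hb Hc; splitmem Ha Hb Hc => //;
   by [move/H1: d => -> | move/D_sym/H1: d => ->; set4].
- by case: s s0 Ha Hb Hc d => -[] Ha Hb Hc d; splitmem Ha Hb Hc.
- by case: s s0 Ha Hb Hc => -[] Ha Hb Hc; splitmem Ha Hb Hc.
Qed.

Lemma covered_pair_side s i a a' c : a <> a' ->
  covered (pt s i a) (pt s i a') (pt s (~~ i) c).
Proof.
move=> aa'; case: i => /=.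
  have [c' H1] := t_matel c aa'.
  exists [set pt s false c; pt s false c'; pt s true a; pt s true a'].
    by apply: BlockT; apply/H1.
  start.
  move=> B [{B} g0 c0 _|{B} s0 x0 x0' k0 z0 z0' d|{B} s0 x0 x0' k0 z0 h0 d
         |{B} s0 x0 x0' u0 u0' d] Ha Hb Hc.
  - by case: s Ha Hb Hc => Ha Hb Hc; move: (emb_pt Ha) (emb_pt Hc) => /=; congruence.
  - by case: s s0 Ha Hb Hc => -[] Ha Hb Hc; splitmem Ha Hb Hc.
  - by case: s s0 Ha Hb Hc d => -[] Ha Hb Hc d; splitmem Ha Hb Hc.
  - by case: s s0 Ha Hb Hc => -[] Ha Hb Hc; splitmem Ha Hb Hc => //;
     first [move/H1: d => -> | move/t_syml/H1: d => ->
     | move/t_symr/H1: d => -> | move/t_symr/t_syml/H1: d => ->]; set4.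
have [c' H1] := t_mater c aa'.
exists [set pt s false a; pt s false a'; pt s true c; pt s true c'].
  by apply: BlockT; apply/H1.
start.
move=> B [{B} g0 c0 _|{B} s0 x0 x0' k0 z0 z0' d|{B} s0 x0 x0' k0 z0 h0 d
       |{B} s0 x0 x0' u0 u0' d] Ha Hb Hc.
- by case: s Ha Hb Hc => Ha Hb Hc; move: (emb_pt Ha) (emb_pt Hc) => /=; congruence.
- by case: s s0 Ha Hb Hc => -[] Ha Hb Hc; splitmem Ha Hb Hc.
- by case: s s0 Ha Hb Hc d => -[] Ha Hb Hc d; splitmem Ha Hb Hc.
- by case: s s0 Ha Hb Hc => -[] Ha Hb Hc; splitmem Ha Hb Hc => //;
   first [move/H1: d => -> | move/t_symr/H1: d => ->
   | move/t_syml/H1: d => -> | move/t_symr/t_syml/H1: d => ->]; set4.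
Qed.

(** A [BlockI] based on either side could contain the triple; [I_cross] says that exactly one side
    does so. *)
Lemma covered_inf_cross h i j x y :
  covered (inf h) (pt false i x) (pt true j y).
Proof.
case: (I_cross h i j x y) => [[x' [H1 H2]]|[y' [H1 H2]]].
  exists [set pt false i x; pt false (~~ i) x'; pt true j y; inf h].
    have := iffRL (H1 x') erefl; case: i {H1 H2} => H /=; last exact: BlockI H.
    (* A point of the group [true] stands second in [BlockI]. *)
    by rewrite [X in X :|: _ :|: _]setUC; exact: BlockI H.
  start.
  move=> B [{B} g0 c0 _|{B} s0 x0 x0' k0 z0 z0' d|{B} s0 x0 x0' k0 z0 h0 d
         |{B} s0 x0 x0' u0 u0' d] Ha Hb Hc.
  - by move: (emb_pt Hb) (emb_pt Hc); congruence.
  - by case: s0 Ha Hb Hc => Ha Hb Hc; splitmem Ha Hb Hc.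
  - case: s0 Ha Hb Hc d => Ha Hb Hc d; splitmem Ha Hb Hc;
     by [case: (H2 _ d) | move/H1: d => ->; set4].
  - by case: s0 Ha Hb Hc => Ha Hb Hc; splitmem Ha Hb Hc.
exists [set pt true j y; pt true (~~ j) y'; pt false i x; inf h].
  have := iffRL (H1 y') erefl; case: j {H1 H2} => H /=; last exact: BlockI H.
  by rewrite [X in X :|: _ :|: _]setUC; exact: BlockI H.
start.
move=> B [{B} g0 c0 _|{B} s0 x0 x0' k0 z0 z0' d|{B} s0 x0 x0' k0 z0 h0 d
       |{B} s0 x0 x0' u0 u0' d] Ha Hb Hc.
- by move: (emb_pt Hb) (emb_pt Hc); congruence.
- by case: s0 Ha Hb Hc => Ha Hb Hc; splitmem Ha Hb Hc.
- case: s0 Ha Hb Hc d => Ha Hb Hc d; splitmem Ha Hb Hc;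
   by [case: (H2 _ d) | move/H1: d => ->; set4].
- by case: s0 Ha Hb Hc => Ha Hb Hc; splitmem Ha Hb Hc.
Qed.

Lemma covered_inf_pts h s i x s' j y : pt s i x <> pt s' j y ->
  covered (inf h) (pt s i x) (pt s' j y).
Proof.
case: (eqVneq (s, i) (s', j)) => [[<- <-]|] npq.
  apply: (@covered_group (s, i) (inl h) (inr x) (inr y)) => //.
  by case=> e; apply: npq; rewrite e.
case: s s' i j npq => -[] [] [] // _ _.
all: first [ exact: covered_inf_cross | apply: coveredAC; exact: covered_inf_cross
  | apply: coveredC; apply: coveredAC; exact: covered_inf_side
  | apply: coveredAC; apply: coveredC; apply: coveredAC; exact: covered_inf_side].
Qed.

Ltac by_kind := first
  [ exact: covered_side_cross
  | by apply: (@covered_pair_cross true); congruence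
  | by apply: (@covered_pair_cross false); congruence
  | by apply: (@covered_pair_side _ true); congruence
  | by apply: (@covered_pair_side _ false); congruence ].

Lemma covered_all p q r : p <> q -> p <> r -> q <> r -> covered p q r.
Proof.
case: p q r => [h|[[s i] x]] [h'|[[s' j] y]] [h''|[[s'' k] z]] pq pr qr.
- apply: (@covered_group (true, true) (inl h) (inl h') (inl h'')); congruence.
- apply: (@covered_group (s'', k) (inl h) (inl h') (inr z)); congruence.
- apply: coveredAC; apply: (@covered_group (s', j) (inl h) (inl h'') (inr y)); congruence.
- exact: covered_inf_pts.
- apply: coveredC; apply: coveredAC.
  apply: (@covered_group (s, i) (inl h') (inl h'') (inr x)); congruence.
- by apply: coveredC; apply: covered_inf_pts.
- by apply: coveredAC; apply: coveredC; apply: covered_inf_pts.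
case: (boolP (((s, i) == (s', j)) && ((s, i) == (s'', k)))) => npq.
  case/andP: npq => /eqP e1 /eqP e2; case: e1 e2 => ? ? [? ?]; subst s' s'' j k.
  by apply: (@covered_group (s, i) (inr x) (inr y) (inr z)); congruence.
(* Three finite points not all in one group either have two in a common group, or lie in three
   groups, two of which form a side. In some order they fit an earlier lemma. *)
case: s s' s'' i j k pq pr qr npq => -[] [] [] [] [] // pq pr qr _.
all: first [by_kind | apply: coveredC; by_kind | apply: coveredAC; by_kind
  | apply: coveredC; apply: coveredAC; by_kind
  | apply: coveredAC; apply: coveredC; by_kind
  | apply: coveredAC; apply: coveredC; apply: coveredAC; by_kind ].
Qed.

Definition assembly : {set {set P}} :=
  [set b | [exists g, exists c : {set bool + V}, (c \in S) && (b == emb g @: c)]] :|: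
  [set b | [exists s, exists x, exists x', exists k, exists z, exists z',
    D x x' k z z' &&
    (b == [set pt s false x; pt s true x'; pt (~~ s) k z; pt (~~ s) k z'])]] :|:
  [set b | [exists s, exists x, exists x', exists k, exists z, exists h,
    I s x x' k z h &&
    (b == [set pt s false x; pt s true x'; pt (~~ s) k z; inf h])]] :|:
  [set b | [exists s, exists a, exists a', exists c, exists c',
    t a a' c c' &&
    (b == [set pt s false a; pt s false a'; pt s true c; pt s true c'])]].

Lemma assemblyP b : reflect (assembly_block b) (b \in assembly).
Proof.
apply: (iffP idP) => [|[g c Sc|s x x' k z z' d|s x x' k z h d|s a a' c c' d]].
- rewrite !inE => /orP[/orP[/orP[]|]|].
  + do 2![case/existsP=> ?]; case/andP=> ? /eqP->; exact: BlockS.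
  + do 6![case/existsP=> ?]; case/andP=> ? /eqP->; exact: BlockD.
  + do 6![case/existsP=> ?]; case/andP=> ? /eqP->; exact: BlockI.
  + do 5![case/existsP=> ?]; case/andP=> ? /eqP->; exact: BlockT.
- rewrite !inE; do 3!(apply/orP; left).
  by apply/existsP; exists g; apply/existsP; exists c; rewrite Sc eqxx.
- rewrite !inE; do 2!(apply/orP; left); apply/orP; right.
  apply/existsP; exists s; apply/existsP; exists x; apply/existsP; exists x'.
  apply/existsP; exists k; apply/existsP; exists z; apply/existsP; exists z'.
  by rewrite d eqxx.
- rewrite !inE; apply/orP; left; apply/orP; right.
  apply/existsP; exists s; apply/existsP; exists x; apply/existsP; exists x'.
  apply/existsP; exists k; apply/existsP; exists z; apply/existsP; exists h.
  by rewrite d eqxx.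
- rewrite !inE; apply/orP; right.
  apply/existsP; exists s; apply/existsP; exists a; apply/existsP; exists a'.
  apply/existsP; exists c; apply/existsP; exists c'.
  by rewrite d eqxx.
Qed.

Lemma assembly_design : S3design K assembly.
Proof.
have [SK SU] := SP; split=> [B /assemblyP[]{B}|T /eqP].
- by move=> g c /SK; rewrite card_imset //; apply: emb_inj.
- move=> s x x' k z z' /D_irr zz'; rewrite cards4 ?K4 //= !inE /pt.
  by case: s => /=; do ?[case: eqP => [e|_]; first by congruence].
- move=> s x x' k z h _; rewrite cards4 ?K4 //= !inE /pt.
  by case: s => /=; do ?[case: eqP => [e|_]; first by congruence].
- move=> s a a' c c' /t_irr[aa' cc']; rewrite cards4 ?K4 //= !inE /pt.
  by do ?[case: eqP => [e|_]; first by congruence].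
move=> /eqP T3; have /card_gt2P[p [q [r [[pT qT rT] [/eqP pq /eqP qr /eqP rp]]]]] : 2 < #|T|.
  by rewrite T3.
have ET : T = [set p; q; r].
  apply/esym/eqP; rewrite eqEcard T3 -setUA cardsU1 cards2 !inE.
  apply/andP; split; last by do ![case: eqP => //]; congruence.
  by apply/subsetP=> w; rewrite !inE => /or3P[]/eqP->.
have [|B0 BB [pB qB rB uB]] := @covered_all p q r pq _ qr; first by congruence.
apply/eqP/cards1P; exists B0; apply/setP=> B; rewrite in_set in_set1 ET -setUA !subUset !sub1set.
apply/andP/eqP => [[/assemblyP BB' /and3P[]]|->]; first exact: uB.
by rewrite pB qB rB; split=> //; apply/assemblyP.
Qed.

End Assembly.

(** * Relabelling of points and the final design *)

Lemma contains_copy_trans (T1 T2 T3 : finType) (B1 : {set {set T1}})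
    (B2 : {set {set T2}}) (B3 : {set {set T3}}) :
  contains_copy B1 B2 -> contains_copy B2 B3 -> contains_copy B1 B3.
Proof.
case=> f [fI fB] [g [gI gB]]; exists (g \o f); split; first exact: inj_comp.
by move=> b /fB/gB; rewrite imset_comp.
Qed.

Definition relabel (T T' : finType) (f : T -> T') (B : {set {set T}}) :=
  [set f @: (b : {set T}) | b in B].

Lemma contains_copy_relabel (T T' : finType) (f : T -> T') (B : {set {set T}}) :
  injective f -> contains_copy B (relabel f B).
Proof. by move=> fI; exists f; split=> // b bB; apply: imset_f. Qed.

Lemma S3design_relabel K (T T' : finType) (f : T -> T') g (B : {set {set T}}) :
  cancel f g -> cancel g f -> S3design K B -> S3design K (relabel f B).
Proof.
move=> fK gK [BK B1]; have fI := can_inj fK; have gI := can_inj gK.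
split=> [_ /imsetP[b bB ->]|t t3]; first by rewrite card_imset //; apply: BK.
have -> : [set b in relabel f B | t \subset b] =
    (fun b : {set T} => f @: b) @: [set b in B | g @: t \subset b].
  have sub (b : {set T}) : (t \subset f @: b) = (g @: t \subset b).
    apply/subsetP/subsetP=> [s _ /imsetP[x /s/imsetP[y yb ->] ->]|s x xt].
      by rewrite fK.
    by rewrite -(gK x) imset_f // s // imset_f.
  apply/setP=> b'; apply/idP/imsetP=> [|[b]]; rewrite !inE.
    case/andP=> /imsetP[b bB ->] tb; exists b => //.
    by rewrite inE bB -sub.
  by case/andP=> bB bt ->; rewrite sub bt andbT imset_f.
by rewrite card_imset ?B1 ?card_imset //; apply: imset_inj.
Qed.

(** All blocks added to the copies of [S] have size 4, so one construction serves every [K]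
    containing 4. The bound [4 < n] makes [n / 2 > 2], as [exists_bbd_relation] requires. *)
Lemma design_8n2 (n : nat) (K : pred nat) (S : {set {set 'I_(2 * n + 2)}})
    (g1 g2 : {set 'I_n}) (Bn : {set {set 'I_n}}) :
  4 < n -> ~~ odd n -> 4 \in K -> S3design K S -> BBD3 g1 g2 Bn ->
  exists S' : {set {set 'I_(8 * n + 2)}},
    [/\ S3design K S', contains_copy S S' & contains_copy Bn S'].
Proof.
move=> n4 on K4 HS BB; have [dis cov eg _ _] := BB.
have cg : n = 2 * #|g1|.
  by rewrite -[LHS]card_ord -cardsT -cov cardsU (disjoint_setI0 dis) cards0 subn0
    -eg addnn mul2n.
have g12 : 2 < #|g1| by rewrite -(ltn_pmul2l (isT : 0 < 2)) -cg.
pose X : finType := 'I_n; pose V : finType := (bool * X)%type.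
have cV : #|V| = 2 * n by rewrite card_prod card_bool card_ord.
(* A group of [2 * n] points is four times as large as a group of [Bn]. *)
have [t [e [Ht e1 e2 eB]]] : exists (t : V -> V -> V -> V -> bool) (e : 'I_n -> V), _ :=
  exists_bbd_relation BB g12 (etrans cV (etrans (congr1 _ cg) (mulnA 2 2 _))).
have oX : ~~ odd #|X| by rewrite card_ord.
have X2 : 2 < #|X| by rewrite card_ord; apply: leq_trans n4.
have [phi [dt [o Hphi]]] := exists_one_factorization oX X2.
have [pi [pinv [st Hpi]]] := exists_idempotent_square oX X2.
have /eq_card_bij[f [g [fK gK]]] : #|'I_(2 * n + 2)| = #|{: bool + V}|.
  by rewrite card_sum cV card_bool card_ord addnC.
have /eq_card_bij[f' [g' [fK' gK']]] : #|points V| = #|'I_(8 * n + 2)|.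
  by rewrite card_sum !card_prod !card_bool !card_ord addnC mulnA.
have HS1 := S3design_relabel fK gK HS.
have [t1 t2 t3 t4 t5] := Ht.
pose As := assembly (crossD dt st o) (crossI dt) t (relabel f S).
have AsP : S3design K As.
  apply: (assembly_design K4 HS1) => //.
  - exact: crossD_irr.
  - exact: (crossD_sym Hphi).
  - exact: (crossDI_mate Hphi Hpi).
  - exact: crossI_mate.
  - exact: (crossD_matel st Hphi).
  - exact: (crossD_mater st Hphi).
  - exact: (crossI_cross Hphi).
have AsF : contains_copy As (relabel f' As).
  by apply: contains_copy_relabel; apply: can_inj fK'.
exists (relabel f' As); split; first exact: S3design_relabel AsP.
- apply: contains_copy_trans AsF.
  apply: (contains_copy_trans (contains_copy_relabel S (can_inj fK))).
  exists (@emb V (false, false)); split; first exact: emb_inj.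
  by move=> b bS; apply/assemblyP; apply: BlockS.
apply: contains_copy_trans AsF.
have g2P x : (x \in g1) = false -> x \in g2.
  by move=> xg; have := in_setT x; rewrite -cov inE xg.
(* The two groups of [Bn] go to the two groups of side [false]; the group bit separates them, and
   [e] is injective on each. *)
exists (fun x => pt false (x \notin g1) (e x)); split=> [x y|b /eB].
  case: (boolP (x \in g1)) (boolP (y \in g1)) => [xg|/negbTE/g2P xg] [yg|/negbTE/g2P yg] //=.
  - by case=> /e1; apply.
  - by case=> /e2; apply.
case=> a [a' [c [c' [[ag ag' cg0 cg'] [-> te]]]]]; apply/assemblyP.
rewrite !imsetU !imset_set1 ag ag' !(disjointFl dis) //=; exact: BlockT.
Qed.

Theorem theorem2 (n : nat) (Hn : 75 < n) (Hev : ~~ odd n) :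
  (forall (S : {set {set 'I_(2 * n + 2)}}) (g1 g2 : {set 'I_n})
          (Bn : {set {set 'I_n}}),
     SQS S -> BBD3 g1 g2 Bn ->
     exists S' : {set {set 'I_(8 * n + 2)}},
       [/\ SQS S', contains_copy S S' & contains_copy Bn S']) /\
  (forall (S : {set {set 'I_(2 * n + 2)}}) (g1 g2 : {set 'I_n})
          (Bn : {set {set 'I_n}}),
     S346 S -> BBD3 g1 g2 Bn ->
     exists S' : {set {set 'I_(8 * n + 2)}},
       [/\ S346 S', contains_copy S S' & contains_copy Bn S']).
Proof.
have n4 : 4 < n by apply: ltn_trans Hn.
by split=> S g1 g2 Bn; apply: design_8n2.
Qed.
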